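(* Let $\varphi \in [-\pi,\pi]$ be a real number. Then $$\frac{2|\varphi|}{\pi} \le \left|1-e^{i\varphi}\right| \le |\varphi| .$$
   Context: Here $i$ is the imaginary unit and $|\cdot|$ denotes the absolute value of a real number or the modulus of a complex number. *)

(* Defs.v *)
From Stdlib Require Import Reals Factorial.
From Coquelicot Require Import Coquelicot.
Open Scope R_scope.

(** [iota] picks the unique sum of the exponential series, which converges
    for every [z]. *)
Definition Cexp (z : C) : C :=
  iota (T := C_CompleteNormedModule)
    (is_series (V := C_NormedModule) (fun n : nat => (z ^ n / INR (fact n))%C)).

(* Main.v *)
Require Import Defs.
From Stdlib Require Import Reals Factorial Lra.
From Coquelicot Require Import Coquelicot.
Open Scope R_scope.

(** The number [|1 - e^(it)|] is the length of the chord of the unit circle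
    that subtends the angle [t], which is [2 |sin (t / 2)|]
    ([Cmod_1_sub_Cexp_Ci]).  With [s = t / 2] in [[-PI/2, PI/2]] the claim
    becomes the pair of bounds [2 |s| / PI <= |sin s| <= |s|]
    ([Rabs_sin_bounds]): on [[0, PI/2]] the sine is concave, so its graph lies
    above the chord from the origin to [(PI/2, 1)] ([sin_ge_chord]), and the
    upper bound is the classical [sin s <= s].

    The chord length rests on Euler's formula ([Cexp_Ci]).  As the exponential
    is given by its power series, the formula is read off termwise: the
    coordinates of [i^n] vanish alternately, and on the remaining parities they
    are the signs of the series that define the real cosine and sine. *)

(** The topology of [C] is that of the product [R * R], so a complex series may
    be summed coordinatewise. *)
Lemma is_series_C (u : nat -> C) (x y : R) :
  is_series (fun n => Re (u n)) x -> is_series (fun n => Im (u n)) y ->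
  is_series (V := C_NormedModule) u (x, y).
Proof.
  intros Hx Hy.
  assert (Hsum : forall n, sum_n (G := C_AbelianMonoid) u n =
                 (sum_n (fun k => Re (u k)) n, sum_n (fun k => Im (u k)) n)).
  { induction n as [|n IH].
    - rewrite !sum_O; apply surjective_pairing.
    - rewrite !sum_Sn, IH; reflexivity. }
  apply (filterlim_locally (U := C_UniformSpace)); intros eps.
  assert (Hx' := proj1 (filterlim_locally _ _) Hx eps).
  assert (Hy' := proj1 (filterlim_locally _ _) Hy eps).
  generalize (filter_and _ _ Hx' Hy'); apply filter_imp; intros n Hn.
  rewrite Hsum; exact Hn.
Qed.

Lemma Cexp_unique (z w : C) :
  is_series (V := C_NormedModule) (fun n => (z ^ n / INR (fact n))%C) w ->
  Cexp z = w.
Proof.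
  intros H.
  exact (iota_filterlim_locally (V := C_CompleteNormedModule) _ _ H).
Qed.

Lemma Ci_pow_even (n : nat) : (Ci ^ (2 * n))%C = ((-1) ^ n : R).
Proof.
  rewrite Cpow_mult_r, RtoC_pow; f_equal.
  unfold Cpow, Ci, RtoC, Cmult; simpl; f_equal; ring.
Qed.

Lemma Ci_pow_odd (n : nat) : (Ci ^ (2 * n + 1))%C = (Ci * ((-1) ^ n : R))%C.
Proof. rewrite Cpow_add_r, Ci_pow_even, Cpow_1_r; apply Cmult_comm. Qed.

(** Keeping the coordinates of [Ci ^ n] symbolic presents both parts as real
    power series in [t] without a case analysis on the parity of [n]. *)
Lemma exp_Ci_term (t : R) (n : nat) :
  ((Ci * t) ^ n / INR (fact n))%C =
  (Re (Ci ^ n) / INR (fact n) * t ^ n, Im (Ci ^ n) / INR (fact n) * t ^ n).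
Proof.
  rewrite Cpow_mult_l, <- RtoC_pow.
  unfold Cdiv; rewrite <- RtoC_inv by apply INR_fact_neq_0.
  destruct (Ci ^ n)%C as [a b].
  unfold Cmult, RtoC, Rdiv; simpl; f_equal; ring.
Qed.

Lemma is_pseries_zero (a : nat -> R) (x : R) :
  (forall n, a n = 0) -> is_pseries a x 0.
Proof.
  intros Ha; apply filterlim_ext with (fun _ => 0); [|apply filterlim_const].
  intros n; symmetry; rewrite (sum_n_ext _ (fun _ => 0)).
  - rewrite sum_n_const; ring.
  - intros k; rewrite Ha; exact (scal_zero_r (pow_n x k)).
Qed.

(** The even coefficients are those of the series in [t ^ 2] that defines [cos];
    the odd ones vanish because odd powers of [Ci] are purely imaginary. *)
Lemma is_pseries_cos (t : R) :
  is_pseries (fun n => Re (Ci ^ n) / INR (fact n)) t (cos t).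
Proof.
  replace (cos t) with (cos t + t * 0) by ring.
  apply is_pseries_odd_even.
  - apply is_pseries_R.
    unfold cos; destruct (exist_cos (Rsqr t)) as [c Hc].
    apply is_series_Reals in Hc; revert Hc; apply is_series_ext; intros n.
    rewrite Ci_pow_even, Rsqr_pow2; reflexivity.
  - apply is_pseries_zero; intros n.
    rewrite Ci_pow_odd; simpl; unfold Rdiv; ring.
Qed.

Lemma is_pseries_sin (t : R) :
  is_pseries (fun n => Im (Ci ^ n) / INR (fact n)) t (sin t).
Proof.
  unfold sin; destruct (exist_sin (Rsqr t)) as [s Hs].
  replace (t * s) with (0 + t * s) by ring.
  apply is_pseries_odd_even.
  - apply is_pseries_zero; intros n.
    rewrite Ci_pow_even; simpl; unfold Rdiv; ring.
  - apply is_pseries_R.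
    apply is_series_Reals in Hs; revert Hs; apply is_series_ext; intros n.
    rewrite Ci_pow_odd, Rsqr_pow2; unfold sin_n; f_equal; f_equal.
    unfold Cmult, Ci, RtoC; cbn -[pow]; ring.
Qed.

Lemma Cexp_Ci (t : R) : Cexp (Ci * t) = (cos t, sin t).
Proof.
  apply Cexp_unique, is_series_C.
  - apply is_series_ext with (2 := proj1 (is_pseries_R _ _ _) (is_pseries_cos t)).
    intros n; rewrite exp_Ci_term; reflexivity.
  - apply is_series_ext with (2 := proj1 (is_pseries_R _ _ _) (is_pseries_sin t)).
    intros n; rewrite exp_Ci_term; reflexivity.
Qed.

(** By the double-angle formulas, [1 - e^(it)] has coordinates [2 s^2] and
    [- 2 s c] with [s = sin (t / 2)] and [c = cos (t / 2)], and
    [4 s^4 + 4 s^2 c^2 = 4 s^2]. *)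
Lemma Cmod_1_sub_Cexp_Ci (t : R) :
  Cmod (1 - Cexp (Ci * t)) = 2 * Rabs (sin (t / 2)).
Proof.
  rewrite Cexp_Ci; unfold Cmod.
  rewrite <- (Rabs_pos_eq 2) at 1 by lra.
  rewrite <- Rabs_mult, <- sqrt_Rsqr_abs; f_equal.
  unfold Rsqr; cbn -[pow].
  replace t with (2 * (t / 2)) at 1 2 by field.
  rewrite cos_2a_sin, sin_2a.
  assert (H := sin2_cos2 (t / 2)); unfold Rsqr in H.
  set (s := sin (t / 2)) in *; set (c := cos (t / 2)) in *.
  transitivity (4 * (s * s) * (s * s + c * c)); [|rewrite H]; ring.
Qed.

(** Jordan's inequality.  The cosine decreases, so the mean slope of [sin] on
    [[0, t]] is at least its mean slope on [[t, PI/2]]: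
    [sin t / t >= (1 - sin t) / (PI/2 - t)], which rearranges to the claim. *)
Lemma sin_ge_chord (t : R) : 0 <= t <= PI / 2 -> 2 * t / PI <= sin t.
Proof.
  intros [Ht0 Ht1].
  assert (HPI := PI_RGT_0).
  destruct (Req_dec t 0) as [->|Hn0].
  { rewrite sin_0; unfold Rdiv; rewrite Rmult_0_r, Rmult_0_l; lra. }
  destruct (Req_dec t (PI / 2)) as [->|Hn1].
  { rewrite sin_PI2; right; field; lra. }
  destruct (MVT_cor2 sin cos 0 t) as [c1 [E1 H1]];
    [lra | intros; apply derivable_pt_lim_sin |].
  destruct (MVT_cor2 sin cos t (PI / 2)) as [c2 [E2 H2]];
    [lra | intros; apply derivable_pt_lim_sin |].
  rewrite sin_0 in E1; rewrite sin_PI2 in E2.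
  assert (Hc : cos c2 < cos c1) by (apply cos_decreasing_1; lra).
  apply Rmult_le_reg_r with PI; [lra|].
  replace (2 * t / PI * PI) with (2 * t) by (field; lra).
  (* The comparison of mean slopes, cleared of denominators. *)
  assert (t * (PI / 2 - t) * cos c2 <= t * (PI / 2 - t) * cos c1)
    by (apply Rmult_le_compat_l; [apply Rmult_le_pos|]; lra).
  nra.
Qed.

Lemma Rabs_sin_bounds (t : R) : - (PI / 2) <= t <= PI / 2 ->
  2 * Rabs t / PI <= Rabs (sin t) <= Rabs t.
Proof.
  intros Ht.
  assert (Hpos : forall s, 0 <= s <= PI / 2 ->
                 2 * s / PI <= Rabs (sin s) <= s).
  { intros s Hs; rewrite Rabs_pos_eq by (apply sin_ge_0; lra).
    split; [now apply sin_ge_chord|].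
    destruct (Req_dec s 0) as [->|Hn0]; [rewrite sin_0; lra|].
    left; apply sin_lt_x; lra. }
  destruct (Rle_or_lt 0 t) as [H0|H0].
  - rewrite (Rabs_pos_eq t) by lra; apply Hpos; lra.
  - rewrite (Rabs_left t), <- (Rabs_Ropp (sin t)), <- sin_neg by lra.
    apply Hpos; lra.
Qed.

Theorem lemma36 (phi : R) (hphi : - PI <= phi <= PI) :
  2 * Rabs phi / PI <= Cmod (1 - Cexp (Ci * phi))%C <= Rabs phi.
Proof.
  rewrite Cmod_1_sub_Cexp_Ci.
  replace (Rabs phi) with (2 * Rabs (phi / 2)).
  - assert (H := Rabs_sin_bounds (phi / 2) ltac:(lra)).
    unfold Rdiv in *; lra.
  - rewrite <- (Rabs_pos_eq 2) at 1 by lra.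
    rewrite <- Rabs_mult; f_equal; field.
Qed.
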